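(* Fix an integer $q\geq 2$ and $\beta>0$. Let $G=(V,E)$ be a graph of maximum degree $\Delta$ and let $\nu=\nu_{G;q,\beta}$ be the Edwards--Sokal distribution. Let $\mu=\mu_{G;q,\beta}$ and $\pi=\pi_{G;q,\beta}$ be the Potts and random-cluster distributions. Suppose that $\mu$ satisfies entropy factorisation with constant $C_{\mathrm{spin}}$. Then, with $C_{\mathrm{joint}}:=O(q^3 e^{3\beta\Delta}C_{\mathrm{spin}})$, for every function $g\ge 0$ on the joint spin-edge space $[q]^V\times\{0,1\}^E$, $$\mathrm{Ent}_\nu(g)\leq C_{\mathrm{joint}}\Bigl(\sum_{v\in V}\mathbb E_\nu\bigl[\mathrm{Ent}^\circ_v(g)\bigr]+\sum_{e\in E}\mathbb E_\nu\bigl[\mathrm{Ent}^\circ_e(g)\bigr]\Bigr).$$ As a corollary, $\pi$ satisfies entropy factorisation with constant $C_{\mathrm{joint}}$.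
   Context: $G$ is a finite graph. Potts distribution on $[q]^V$: $\mu(\sigma)\propto\exp(\beta\sum_{\{u,v\}\in E}\mathbf 1\{\sigma_u=\sigma_v\})$. Random-cluster distribution on edge subsets $F\subseteq E$ (identified with $\{0,1\}^E$): $\pi(F)\propto q^{k(F)}(e^\beta-1)^{|F|}$, where $k(F)$ is the number of connected components of $(V,F)$. Edwards--Sokal distribution on pairs $(\sigma,A)\in[q]^V\times\{0,1\}^E$: $\nu(\sigma,A)\propto(e^\beta-1)^{|A^{\mathrm{in}}|}\mathbf 1\{A^{\mathrm{in}}\subseteq M(\sigma)\}$, where $A^{\mathrm{in}}$ is the set of edges assigned $1$ by $A$ and $M(\sigma)$ is the set of edges that are monochromatic under $\sigma$; its marginals on $\sigma$ and $A$ are $\mu$ and $\pi$. For $f\ge0$ and a distribution $\lambda$, $\mathrm{Ent}_\lambda(f)=\mathbb E_\lambda[f\log f]-\mathbb E_\lambda[f]\log\mathbb E_\lambda[f]$. For a single coordinate $x$ (a vertex or an edge), $\mathrm{Ent}_x^\circ(f)$ is the function mapping a configuration $\tau$ in the support to the entropy of $f$ under the distribution conditioned on all coordinates other than $x$ agreeing with $\tau$ (so only coordinate $x$ is resampled). A distribution $\lambda$ on configurations indexed by a finite coordinate set $X$ satisfies entropy factorisation with constant $C$ if $\mathrm{Ent}_\lambda(f)\le C\sum_{x\in X}\mathbb E_\lambda[\mathrm{Ent}^\circ_x(f)]$ for all $f\ge0$ (with $X=V$ for $\mu$ and $X=E$ for $\pi$). The $O(\cdot)$ hides an absolute constant. 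*)

(* Defs.v *)
From HB Require Import structures.
From mathcomp Require Import all_boot all_order all_algebra.
From mathcomp Require Import reals.
From mathcomp.analysis Require Import sequences exp.

Set Implicit Arguments.
Unset Strict Implicit.
Unset Printing Implicit Defensive.

Import Order.TTheory GRing.Theory Num.Theory.
Local Open Scope ring_scope.

Record sgraph := SGraph {
  vertex :> finType;
  adj : rel vertex;
  adj_sym : symmetric adj;
  adj_irr : irreflexive adj
}.

Section Graph.
Variable G : sgraph.

Definition edge_set : {set {set G}} :=
  [set [set p.1; p.2] | p : G * G & adj p.1 p.2].

Definition edge : finType := {e : {set G} | e \in edge_set}.

Definition degree (v : G) : nat := #|[set u | adj v u]|.

Definition max_degree : nat := \max_(v : G) degree v.

Definition spin_config (q : nat) : finType := {ffun G -> 'I_q}.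

Definition edge_config : finType := {ffun edge -> bool}.

Definition open_edges (A : edge_config) : {set edge} := [set e | A e].

Definition mono_edges (q : nat) (s : spin_config q) : {set edge} :=
  [set e : edge | [forall u in val e, forall v in val e, s u == s v]].

(* [set u; v] = [set v; u], so this relation is symmetric, as n_comp requires. *)
Definition open_rel (A : edge_config) : rel G :=
  fun u v => [exists e in open_edges A, val e == [set u; v]].

Definition num_components (A : edge_config) : nat := n_comp (open_rel A) G.

End Graph.

Section Distributions.
Variables (R : realType) (W : finType).
Implicit Types (w lam f : W -> R) (B : pred W).

Definition normalise w : W -> R := fun x => w x / \sum_y w y.

(* lam conditioned on B; the null function if lam(B) = 0. *)
Definition condition lam B : W -> R :=
  normalise (fun x => if B x then lam x else 0).

Definition expect lam f : R := \sum_x lam x * f x.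

(* ln 0 = 0 in the library, so 0 log 0 = 0. *)
Definition Ent lam f : R :=
  expect lam (fun x => f x * ln (f x)) - expect lam f * ln (expect lam f).

(* agree t is the set of configurations that agree with t on every coordinate
   except the one being resampled. *)
Definition cond_Ent (agree : rel W) lam f : W -> R :=
  fun t => Ent (condition lam (agree t)) f.

End Distributions.

Definition agree_off (X S : finType) (x : X) : rel {ffun X -> S} :=
  fun s t => [forall y, (y != x) ==> (s y == t y)].

Definition entropy_factorisation (R : realType) (X S : finType)
    (lam : {ffun X -> S} -> R) (C : R) : Prop :=
  forall f : {ffun X -> S} -> R, (forall s, 0 <= f s) ->
    Ent lam f <= C * \sum_(x : X) expect lam (cond_Ent (agree_off x) lam f).

Section Models.
Variables (R : realType) (G : sgraph) (q : nat) (beta : R).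

Definition joint_config : finType := (spin_config G q * edge_config G)%type.

Definition potts : spin_config G q -> R :=
  normalise (fun s => expR (beta * #|mono_edges s|%:R)).

Definition random_cluster : edge_config G -> R :=
  normalise (fun A =>
    q%:R ^+ num_components A * (expR beta - 1) ^+ #|open_edges A|).

Definition edwards_sokal : joint_config -> R :=
  normalise (fun t : joint_config => (expR beta - 1) ^+ #|open_edges t.2| *
    (open_edges t.2 \subset mono_edges t.1)%:R).

Definition agree_off_vertex (v : G) : rel joint_config :=
  fun t u => agree_off v t.1 u.1 && (t.2 == u.2).

Definition agree_off_edge (e : edge G) : rel joint_config :=
  fun t u => (t.1 == u.1) && agree_off e t.2 u.2.

End Models.

Arguments potts {R} G q beta _.
Arguments random_cluster {R} G q beta _.
Arguments edwards_sokal {R} G q beta _.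
Arguments joint_config G q : clear implicits.

(* Main.v *)
(** For an equivalence relation [e] on configurations write L(e) for
    E[g log E[g | e]], with L(=) = E[g log g]; every entropy in the statement is
    a difference of two such terms.  The edges are conditionally independent
    given the spins, so L(=) - L(spins) tensorises over the edges, by the
    submodularity of L under conditional independence.  The spin factorisation
    bounds L(spins) - L(const) by a sum over the vertices v of
    L(spins) - L(spins off v).  Submodularity again allows one to condition on
    the edges not incident to v, which reduces this term to an inequality on the
    star of v.  There entropy and the variance of a square root are comparable,
    and spin and edges are linked through the configurations in which all the
    edges of the star are closed, where the spin at v is free.

    The tensorised part comes with the constant 1, which is absorbed because a
    spin factorisation constant is at least 1 (when there is a vertex).  For the
    random-cluster model one takes g to depend on the edges only: the vertex
    terms vanish, and conditioning on the spins as well decreases the edge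
    terms. *)

Require Import Defs.
From mathcomp Require Import all_boot all_order all_algebra.
From mathcomp Require Import reals.
From mathcomp.analysis Require Import sequences exp.
From mathcomp Require Import ring lra.

Set Implicit Arguments.
Unset Strict Implicit.
Unset Printing Implicit Defensive.

Import Order.TTheory GRing.Theory Num.Theory.
Local Open Scope ring_scope.

(** * Conditional expectations on the classes of an equivalence relation *)

Section CondExp.
Context {R : realType} {W : finType}.
Implicit Types (e a b c d : rel W) (h f k lam : W -> R).

(** The bound [ln z <= z - 1] at [z = y / x], cleared of the denominator so that it survives
    [x = 0]. *)
Lemma mul_lnB_le (x y : R) : 0 <= x -> 0 <= y -> (0 < x -> 0 < y) ->
  x * (ln y - ln x) <= y - x.
Proof.
move=> x0 y0 xy.
have [x_le0|x_gt0] := lerP x 0.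
  have -> : x = 0 by lra.
  by rewrite mul0r subr0.
have y_gt0 := xy x_gt0.
have -> : y = x * (1 + (y / x - 1)) by field; lra.
have yx : 0 < y / x by rewrite divr_gt0.
have H : ln (1 + (y / x - 1)) <= y / x - 1 by apply: le_ln1Dx; lra.
rewrite lnM ?posrE //; last by lra.
have -> : ln x + ln (1 + (y / x - 1)) - ln x = ln (1 + (y / x - 1)) by ring.
have -> : x * (1 + (y / x - 1)) - x = x * (y / x - 1) by ring.
by rewrite ler_wpM2l.
Qed.

Definition mass e h (t : W) : R := \sum_s (e t s)%:R * h s.

(** Conditional expectation given the class of [t]; division by zero gives 0 on classes of
    [lam]-mass zero, which carry no weight. *)
Definition cexp lam e f t := mass e (fun s => lam s * f s) t / mass e lam t.

(** The functional L. Weighting the logarithm by [f] or by [cexp lam e f] makes no difference, by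
    [sum_cexp_mul]. *)
Definition loge lam e f := \sum_t lam t * f t * ln (cexp lam e f t).

Lemma eq_mass e e' h h' : e =2 e' -> h =1 h' -> mass e h =1 mass e' h'.
Proof. by move=> ee' hh' t; apply: eq_bigr => s _; rewrite ee' hh'. Qed.

Lemma eq_loge lam e e' f : e =2 e' -> loge lam e f = loge lam e' f.
Proof.
move=> ee'; apply: eq_bigr => t _; congr (_ * ln _).
by rewrite /cexp !(eq_mass ee' (frefl _)).
Qed.

Lemma mass_ge0 e h t : (forall s, 0 <= h s) -> 0 <= mass e h t.
Proof. by move=> h0; apply: sumr_ge0 => s _; rewrite mulr_ge0. Qed.

Lemma le_mass e e' h t : (forall s, 0 <= h s) -> subrel e e' ->
  mass e h t <= mass e' h t.
Proof.
move=> h0 ee'; apply: ler_sum => s _; apply: ler_wpM2r => //.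
by rewrite ler_nat; case: (boolP (e t s)) => [/ee' ->|].
Qed.

Lemma equivalence_refl e : equivalence_rel e -> reflexive e.
Proof. by move=> eE t; case: (eE t t t). Qed.

Lemma equivalence_inv e t s : equivalence_rel e -> e t s -> e t =1 e s.
Proof. by move=> eE ts u; apply: (eE t s u).2. Qed.

Lemma equivalence_sym e : equivalence_rel e -> symmetric e.
Proof.
move=> eE t s; apply/idP/idP => H.
  by rewrite -(equivalence_inv eE H) equivalence_refl.
by rewrite -(equivalence_inv eE H) equivalence_refl.
Qed.

Lemma mass_inv e h t s : equivalence_rel e -> e t s -> mass e h t = mass e h s.
Proof. by move=> eE ts; apply: eq_bigr => u _; rewrite (equivalence_inv eE ts). Qed.

Lemma ge_mass e h t : equivalence_rel e -> (forall s, 0 <= h s) ->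
  h t <= mass e h t.
Proof.
move=> eE h0; rewrite /mass (bigD1 t) //= equivalence_refl // mul1r lerDl.
by apply: sumr_ge0 => s _; rewrite mulr_ge0.
Qed.

Lemma mass_gt0 e h t : equivalence_rel e -> (forall s, 0 <= h s) ->
  0 < h t -> 0 < mass e h t.
Proof. by move=> eE h0 ht; apply: lt_le_trans ht (ge_mass _ eE h0). Qed.

Lemma mass_mulr e h k t : equivalence_rel e ->
  (forall t s, e t s -> k t = k s) ->
  mass e (fun s => h s * k s) t = mass e h t * k t.
Proof.
move=> eE kI; rewrite /mass mulr_suml; apply: eq_bigr => s _.
by case: (boolP (e t s)) => [/kI ->|_]; rewrite ?mulrA // !mul0r.
Qed.

(** Symmetry of [e] makes the class sum a self-adjoint operator. *)
Lemma mass_swap e h k : equivalence_rel e ->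
  \sum_t k t * mass e h t = \sum_t mass e k t * h t.
Proof.
move=> eE; under eq_bigr do rewrite mulr_sumr.
rewrite exchange_big /=; apply: eq_bigr => s _; rewrite mulr_suml.
apply: eq_bigr => t _; rewrite (equivalence_sym eE); ring.
Qed.

Lemma mass_eq_op h t : mass eq_op h t = h t.
Proof.
rewrite /mass (bigD1 t) //= eqxx mul1r big1 ?addr0 // => s st.
by rewrite eq_sym (negbTE st) mul0r.
Qed.

Section Weight.
Variables (lam : W -> R) (lam_ge0 : forall t, 0 <= lam t).
Local Notation cexp := (cexp lam).
Local Notation loge := (loge lam).

Lemma ltW_neq0 t : lam t != 0 -> 0 < lam t.
Proof. by move=> lt; rewrite lt_neqAle eq_sym lt /=. Qed.

Lemma ge0_mulf f : (forall t, 0 <= f t) -> forall t, 0 <= lam t * f t.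
Proof. by move=> f0 t; rewrite mulr_ge0. Qed.

Lemma cexp_ge0 e f t : (forall t, 0 <= f t) -> 0 <= cexp e f t.
Proof. by move=> f0; rewrite divr_ge0 ?mass_ge0 //; apply: ge0_mulf. Qed.

Lemma cexp_gt0 e f t : equivalence_rel e -> (forall t, 0 <= f t) ->
  0 < lam t -> 0 < f t -> 0 < cexp e f t.
Proof.
by move=> eE f0 lt ft; rewrite divr_gt0 ?mass_gt0 ?mulr_gt0 //; apply: ge0_mulf.
Qed.

Lemma cexp_inv e f t s : equivalence_rel e -> e t s -> cexp e f t = cexp e f s.
Proof. by move=> eE ts; rewrite /cexp !(mass_inv _ eE ts). Qed.

Lemma cexp_mass e f t : equivalence_rel e -> 0 < lam t ->
  cexp e f t * mass e lam t = mass e (fun s => lam s * f s) t.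
Proof. by move=> eE lt; rewrite /cexp divfK // gt_eqF // mass_gt0. Qed.

(** The tower property: self-adjointness moves the class sum onto [lam] times a function constant on
    classes. *)
Lemma sum_cexp_mul e f k : equivalence_rel e ->
  (forall t s, e t s -> k t = k s) ->
  \sum_t lam t * cexp e f t * k t = \sum_t lam t * f t * k t.
Proof.
move=> eE kI.
transitivity (\sum_t lam t * (k t / mass e lam t) * mass e (fun s => lam s * f s) t).
  by apply: eq_bigr => t _; rewrite /cexp; ring.
rewrite mass_swap //; apply: eq_bigr => t _; rewrite mass_mulr //; last first.
  by move=> u s us; rewrite (kI _ _ us) (mass_inv _ eE us).
have [->|/ltW_neq0 lt] := eqVneq (lam t) 0; first by rewrite !mul0r mulr0.
by have := mass_gt0 eE lam_ge0 lt => H; field; lra.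
Qed.

Lemma sum_cexp e f : equivalence_rel e ->
  \sum_t lam t * cexp e f t = \sum_t lam t * f t.
Proof.
move=> eE; have := sum_cexp_mul f eE (fun _ _ _ => erefl 1).
by under eq_bigr do rewrite mulr1; under [in RHS]eq_bigr do rewrite mulr1.
Qed.

Lemma cexp_eq_op f t : 0 < lam t -> cexp eq_op f t = f t.
Proof. by move=> lt; rewrite /cexp !mass_eq_op; field; lra. Qed.

Lemma loge_eq_op f : loge eq_op f = \sum_t lam t * f t * ln (f t).
Proof.
apply: eq_bigr => t _; have [->|/ltW_neq0 lt] := eqVneq (lam t) 0.
  by rewrite !mul0r.
by rewrite cexp_eq_op.
Qed.

(** The tower property removes the inner averages and turns every averaged local entropy into a
    difference of two values of L. *)
Lemma expect_cond_Ent e f : equivalence_rel e ->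
  expect lam (cond_Ent e lam f) = loge eq_op f - loge e f.
Proof.
move=> eE; rewrite loge_eq_op.
have E h t : expect (condition lam (e t)) h = cexp e h t.
  rewrite /cexp /mass mulr_suml; apply: eq_bigr => s _.
  rewrite /condition /normalise.
  have -> : \sum_y (if e t y then lam y else 0) = \sum_s (e t s)%:R * lam s.
    by apply: eq_bigr => y _; case: ifP; rewrite ?mul1r ?mul0r.
  by case: ifP => _; rewrite ?mul1r ?mul0r //; ring.
rewrite /expect; under eq_bigr => t _.
  rewrite /cond_Ent /Ent !E mulrBr [lam t * (_ * ln _)]mulrA; over.
rewrite sumrB sum_cexp // sum_cexp_mul //; last first.
  by move=> t s ts; rewrite (cexp_inv _ eE ts).
by congr (_ - _); apply: eq_bigr => t _; rewrite mulrA.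
Qed.

Lemma Ent_loge f : \sum_t lam t = 1 ->
  Ent lam f = loge eq_op f - loge (fun _ _ => true) f.
Proof.
move=> lam1; rewrite loge_eq_op /Ent; congr (_ - _).
  by apply: eq_bigr => t _; rewrite mulrA.
rewrite /loge /cexp /mass.
have -> : \sum_s true%:R * lam s = 1.
  by rewrite -[RHS]lam1; apply: eq_bigr => s _; rewrite mul1r.
rewrite -mulr_suml; congr (_ * ln _).
by rewrite divr1; apply: eq_bigr => s _; rewrite mul1r.
Qed.

(** A Gibbs inequality: after [ln z <= z - 1] the linear terms cancel, because both conditional
    expectations have the mean of [f]. *)
Lemma loge_mono e d f : equivalence_rel e -> equivalence_rel d ->
  (forall t, 0 <= f t) -> subrel e d -> loge d f <= loge e f.
Proof.
move=> eE dE f0 ed; rewrite -subr_ge0 -oppr_le0 opprB -sumrB.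
have ed' k : (forall t s, d t s -> k t = k s) -> forall t s : W, e t s -> k t = k s :> R.
  by move=> kI t s /ed; apply: kI.
rewrite (_ : \sum_i _ = \sum_t lam t * (cexp e f t * (ln (cexp d f t) - ln (cexp e f t)))).
  apply: le_trans (_ : \sum_t lam t * (cexp d f t - cexp e f t) <= _); last first.
    under eq_bigr do rewrite mulrBr.
    by rewrite sumrB !sum_cexp // subrr.
  apply: ler_sum => t _; have [->|/ltW_neq0 lt] := eqVneq (lam t) 0.
    by rewrite !mul0r.
  rewrite ler_wpM2l //; apply: mul_lnB_le; rewrite ?cexp_ge0 //.
  rewrite -(pmulr_lgt0 _ (mass_gt0 eE lam_ge0 lt)) cexp_mass // => H.
  rewrite -(pmulr_lgt0 _ (mass_gt0 dE lam_ge0 lt)) cexp_mass //.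
  by apply: lt_le_trans H (le_mass _ _ ed); apply: ge0_mulf.
under [RHS]eq_bigr do rewrite mulrA; rewrite sum_cexp_mul //.
  by apply: eq_bigr => t _; ring.
by move=> t s ts; rewrite (cexp_inv _ dE (ed _ _ ts)) (cexp_inv _ eE ts).
Qed.

(* The hypothesis on masses says that [a] and [b] are conditionally independent
   given [c]; the log-likelihood ratio is bounded by [ln x <= x - 1]. *)
Lemma loge_submod a b ab c f :
    equivalence_rel a -> equivalence_rel b -> equivalence_rel ab ->
    equivalence_rel c -> subrel a c -> subrel b c ->
    (forall t s, ab t s = a t s && b t s) ->
    (forall t, mass a lam t * mass b lam t = mass c lam t * mass ab lam t) ->
    (forall t, 0 <= f t) ->
  loge a f + loge b f <= loge ab f + loge c f.
Proof.
move=> aE bE abE cE ac bc abP indep f0.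
pose n t := lam t * f t.
have n0 t : 0 <= n t by rewrite mulr_ge0.
have ng0 t : n t != 0 -> 0 < n t by rewrite lt_neqAle eq_sym n0 => ->.
rewrite -subr_ge0 -oppr_le0 opprB -!big_split /= -sumrB.
(* Bounding the logarithm by its argument minus 1 leaves an inequality between masses of [n]. *)
apply: le_trans (_ : \sum_t (n t * (mass a n t * mass b n t /
   (mass c n t * mass ab n t)) - n t) <= _).
  apply: ler_sum => t _; rewrite -/(n t) -!mulrDr -mulrBr.
  have [->|/ng0 nt] := eqVneq (n t) 0; first by rewrite !mul0r subr0.
  have lt : 0 < lam t.
    by apply: ltW_neq0; apply: contraTneq nt => l0; rewrite /n l0 mul0r ltxx.
  have := indep t.
  rewrite /cexp -/n.
  have P e : equivalence_rel e -> 0 < mass e n t /\ 0 < mass e lam t.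
    by move=> eE; rewrite !mass_gt0.
  case: (P a aE) (P b bE) (P ab abE) (P c cE) => [Na Pa] [Nb Pb] [Nab Pab] [Nc Pc] ind.
  rewrite -!lnM ?posrE ?divr_gt0 // -[X in _ <= _ - X]mulr1 -mulrBr ler_pM2l //.
  rewrite -ln_div ?posrE ?mulr_gt0 ?divr_gt0 ?invr_gt0 //.
  set x := (X in ln X).
  (* The masses of [lam] cancel by conditional independence. *)
  have -> : x = mass a n t * mass b n t / (mass c n t * mass ab n t).
    rewrite /x -[LHS]mulr1 -[X in _ * X](divff (_ : mass a lam t * mass b lam t != 0)).
      by rewrite {2}ind; field; lra.
    by rewrite mulf_neq0 ?gt_eqF.
  have := @mul_lnB_le 1 (mass a n t * mass b n t / (mass c n t * mass ab n t)).
  rewrite ln1 subr0 mul1r; apply; rewrite ?ler01 //.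
    by rewrite divr_ge0 ?mulr_ge0 ?ltW.
  by rewrite divr_gt0 ?mulr_gt0.
rewrite sumrB subr_le0.
rewrite (_ : \sum_i _ = \sum_s n s * \sum_u n u *
  \sum_t (a t s)%:R * (b t u)%:R * (n t / (mass c n t * mass ab n t))); last first.
  under [RHS]eq_bigr => s _ do (rewrite mulr_sumr;
    under eq_bigr do rewrite mulrCA !mulr_sumr).
  under [RHS]eq_bigr do rewrite exchange_big /=.
  rewrite exchange_big /=; apply: eq_bigr => t _.
  rewrite {1 2}/mass mulr_suml mulr_suml mulr_sumr; apply: eq_bigr => s _.
  rewrite mulr_sumr mulr_suml mulr_sumr; apply: eq_bigr => u _; ring.
(* For fixed [s] and [u] the contributing [t] form at most one class of [ab], inside the class of
   [c] containing [s], so the sum over [t] is at most the inverse of [mass c n s]. *)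
apply: le_trans (_ : \sum_s n s * \sum_u n u * ((c s u)%:R / mass c n s) <= _).
  apply: ler_sum => s _; rewrite ler_wpM2l //.
  apply: ler_sum => u _; rewrite ler_wpM2l //.
  have rhs0 : 0 <= (c s u)%:R / mass c n s by rewrite divr_ge0 ?mass_ge0.
  case: (pickP (fun t => a t s && b t u)) => [t0 /= /andP[ts tu]|none]; last first.
    rewrite big1 // => t _; have := none t.
    by move=> /= /negbT/nandP[]/negbTE->; rewrite !(mulr0, mul0r).
  have cts := ac _ _ ts; have ctu := bc _ _ tu.
  have csu : c s u by rewrite -(equivalence_inv cE cts).
  rewrite csu.
  rewrite (_ : \sum_i _ = (mass ab n t0 / mass ab n t0) / mass c n s).
    rewrite ler_wpM2r ?invr_ge0 ?mass_ge0 //.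
    have [->|H] := eqVneq (mass ab n t0) 0; first by rewrite mul0r ler01.
    by rewrite divff.
  rewrite [X in X / _ / _]/mass mulr_suml mulr_suml; apply: eq_bigr => t _.
  have -> : a t s = a t0 t by rewrite (equivalence_inv aE ts) (equivalence_sym aE).
  have -> : b t u = b t0 t by rewrite (equivalence_inv bE tu) (equivalence_sym bE).
  have -> : (ab t0 t)%:R = (a t0 t)%:R * (b t0 t)%:R :> R by rewrite abP -natrM mulnb.
  case: (boolP (a t0 t)) => [a0|_]; last by rewrite !mul0r.
  case: (boolP (b t0 t)) => [b0|_]; last by rewrite !(mulr0,mul0r).
  have ab0 : ab t0 t by rewrite abP a0.
  rewrite -(mass_inv n abE ab0) -(mass_inv n cE (ac _ _ a0)) (mass_inv n cE cts) invfM.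
  ring.
apply: ler_sum => s _; rewrite -[X in _ <= X]mulr1 ler_wpM2l //.
rewrite (_ : \sum_i _ = mass c n s / mass c n s); last first.
  by rewrite [X in _ = X / _]/mass mulr_suml; apply: eq_bigr => u _; ring.
have [->|H] := eqVneq (mass c n s) 0; first by rewrite mul0r ler01.
by rewrite divff.
Qed.

(** * Entropy and the variance of the square root *)

Lemma ln_sqrt2 (x : R) : 0 <= x -> ln x = 2 * ln (Num.sqrt x).
Proof.
rewrite le_eqVlt => /predU1P[<-|x0]; first by rewrite sqrtr0 ln0 // mulr0.
by rewrite -{1}(sqr_sqrtr (ltW x0)) lnXn ?sqrtr_gt0 // mulr_natl.
Qed.

(** The variance is at most the mean square distance of [sqrt f] to the root of the conditional
    expectation of [f], which a pointwise logarithmic bound controls. *)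
Lemma var_sqrt_le_loge e f : equivalence_rel e -> (forall t, 0 <= f t) ->
  \sum_t lam t * (Num.sqrt (f t) - cexp e (fun s => Num.sqrt (f s)) t) ^+ 2 <=
    loge eq_op f - loge e f.
Proof.
move=> eE f0; set x := fun s => Num.sqrt (f s); set m := cexp e x.
pose c := cexp e f; pose y t := Num.sqrt (c t).
have c0 t : 0 <= c t by apply: cexp_ge0.
have mI t s : e t s -> m t = m s by move=> ts; apply: cexp_inv.
have yI t s : e t s -> y t = y s.
  by move=> ts; rewrite /y; congr Num.sqrt; apply: cexp_inv.
have S1 := sum_cexp f eE; have S2 := sum_cexp_mul x eE yI.
have S3 := sum_cexp_mul x eE mI.
(* The intermediate sum is the mean of [(x - y) ^+ 2], since [y ^+ 2] and [f] have equal means. *)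
apply: le_trans (_ : \sum_t lam t * (2 * f t - 2 * (x t * y t)) <= _).
  rewrite -subr_ge0 (_ : _ - _ = \sum_t lam t * (m t - y t) ^+ 2).
    by apply: sumr_ge0 => t _; rewrite mulr_ge0 ?sqr_ge0.
  have -> : \sum_t lam t * (2 * f t - 2 * (x t * y t)) =
      2 * \sum_t lam t * f t - 2 * \sum_t lam t * x t * y t.
    by rewrite !mulr_sumr -sumrB; apply: eq_bigr => t _; ring.
  have -> : \sum_t lam t * (x t - m t) ^+ 2 =
      \sum_t lam t * f t - 2 * \sum_t lam t * x t * m t +
      \sum_t lam t * m t * m t.
    rewrite mulr_sumr -sumrB -big_split; apply: eq_bigr => t _ /=.
    by rewrite -[f t]sqr_sqrtr // -/(x t); ring.
  have -> : \sum_t lam t * (m t - y t) ^+ 2 =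
      \sum_t lam t * m t * m t - 2 * \sum_t lam t * m t * y t +
      \sum_t lam t * c t.
    rewrite mulr_sumr -sumrB -big_split; apply: eq_bigr => t _ /=.
    by rewrite -[c t]sqr_sqrtr // -/(y t); ring.
  rewrite -/c in S1; rewrite -/m in S2 S3; lra.
rewrite loge_eq_op -sumrB; apply: ler_sum => t _; rewrite -!mulrBr -mulrA.
have [->|/ltW_neq0 lt] := eqVneq (lam t) 0; first by rewrite !mul0r.
rewrite ler_wpM2l // -/(c t) (ln_sqrt2 (f0 t)) (ln_sqrt2 (c0 t)) -/(x t) -/(y t).
have x0 : 0 <= x t by apply: sqrtr_ge0.
have H : x t * (ln (y t) - ln (x t)) <= y t - x t.
  apply: mul_lnB_le; rewrite ?sqrtr_ge0 // !sqrtr_gt0 => ft.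
  exact: cexp_gt0.
have := ler_wpM2l x0 H.
by rewrite -[f t]sqr_sqrtr // -/(x t); lra.
Qed.

(** Conditional expectation is the orthogonal projection onto the functions constant on the classes
    of [d]. *)
Lemma var_min d f k : equivalence_rel d -> (forall t s, d t s -> k t = k s) ->
  \sum_t lam t * (f t - cexp d f t) ^+ 2 <= \sum_t lam t * (f t - k t) ^+ 2.
Proof.
move=> dE kI; set m := cexp d f.
have mI t s : d t s -> m t = m s by move=> ts; apply: cexp_inv.
have S2 := sum_cexp_mul f dE kI; have S3 := sum_cexp_mul f dE mI.
rewrite -subr_ge0 (_ : _ - _ = \sum_t lam t * (m t - k t) ^+ 2).
  by apply: sumr_ge0 => t _; rewrite mulr_ge0 ?sqr_ge0.
have E g h : \sum_t lam t * (g t - h t) ^+ 2 = \sum_t lam t * g t * g t -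
    2 * \sum_t lam t * g t * h t + \sum_t lam t * h t * h t.
  by rewrite mulr_sumr -sumrB -big_split; apply: eq_bigr => t _ /=; ring.
rewrite !E; rewrite -/m in S2 S3; lra.
Qed.

(** A converse to [var_sqrt_le_loge], where [p] bounds from below the conditional probability of a
    class of [e] in its class of [d]. The centre [k] is left free so that it can be computed at a
    modified configuration. *)
Lemma loge_le_var e d f k (p : R) : equivalence_rel e -> equivalence_rel d ->
    subrel e d -> (forall t, 0 <= f t) -> (forall t s, d t s -> k t = k s) ->
    0 < p -> p <= 1 -> (forall t, p * mass d lam t <= mass e lam t) ->
  loge e f - loge d f <=
    3 / p * \sum_t lam t * (Num.sqrt (cexp e f t) - k t) ^+ 2.
Proof.
move=> eE dE ed f0 kI p0 p1 pP.
set x := fun t => Num.sqrt (cexp e f t); pose m := cexp d x; pose c := cexp d f.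
pose h := cexp e f.
have h0 t : 0 <= h t by apply: cexp_ge0.
have x0 t : 0 <= x t by apply: sqrtr_ge0.
have xI t s : e t s -> x t = x s.
  by move=> ts; rewrite /x; congr Num.sqrt; apply: cexp_inv.
have mI t s : d t s -> m t = m s by move=> ts; apply: cexp_inv.
have cI t s : d t s -> c t = c s by move=> ts; apply: cexp_inv.
have m0 t : 0 <= m t by apply: cexp_ge0.
have c0 t : 0 <= c t by apply: cexp_ge0.
(* The class of [e], on which [x] is constant, has weight at least [p] in the average [m]. *)
have xm t : 0 < lam t -> p * x t <= m t.
  move=> lt; have Pd := mass_gt0 dE lam_ge0 lt.
  rewrite -(ler_pM2r Pd) cexp_mass // mulrAC.
  apply: le_trans (_ : mass e lam t * x t <= _).
    by rewrite ler_wpM2r.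
  by rewrite -mass_mulr //; apply: le_mass => // s; rewrite mulr_ge0.
apply: le_trans (_ : 3 / p * \sum_t lam t * (x t - m t) ^+ 2 <= _); last first.
  by rewrite ler_wpM2l ?var_min // divr_ge0 // ltW.
have -> : loge e f - loge d f = \sum_t lam t * h t * (ln (h t) - ln (c t)).
  rewrite sum_cexp_mul // -?sumrB; last first.
    move=> t s ts; rewrite (cI _ _ (ed _ _ ts)).
    by rewrite /h (cexp_inv f eE ts).
  by apply: eq_bigr => t _; rewrite mulrBr.
(* The logarithm of [h / c] is [2 ln (x / m) + ln (m ^+ 2 / c)], and [ln z <= z - 1] applies to both
   parts. *)
apply: le_trans (_ : \sum_t lam t * (h t * (2 * x t / m t - 3)) +
   \sum_t lam t * f t * (m t ^+ 2 / c t) <= _).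
  rewrite -(sum_cexp_mul f eE); last first.
    by move=> t s /ed ts; rewrite (mI _ _ ts) (cI _ _ ts).
  rewrite -/h -big_split; apply: ler_sum => t _ /=.
  rewrite -[_ * h t * (ln _ - _)]mulrA -[_ * h t * (_ / _)]mulrA -mulrDr.
  have [->|/ltW_neq0 lt] := eqVneq (lam t) 0; first by rewrite !mul0r.
  rewrite ler_wpM2l //.
  have := h0 t; rewrite le_eqVlt => /predU1P[<-|ht]; first by rewrite !mul0r addr0.
  rewrite -mulrDr ler_wpM2l //.
  have xt : 0 < x t by rewrite sqrtr_gt0.
  have mt : 0 < m t by apply: lt_le_trans (xm _ lt); rewrite mulr_gt0.
  have ct : 0 < c t.
    rewrite -(pmulr_lgt0 _ (mass_gt0 dE lam_ge0 lt)) cexp_mass //.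
    apply: lt_le_trans (le_mass t (ge0_mulf f0) ed).
    by rewrite -cexp_mass // mulr_gt0 // mass_gt0.
  have H1 : 1 * (ln (x t / m t) - ln 1) <= x t / m t - 1.
    exact: mul_lnB_le ler01 (divr_ge0 (x0 t) (m0 t)) (fun=> divr_gt0 xt mt).
  have H2 : 1 * (ln (m t ^+ 2 / c t) - ln 1) <= m t ^+ 2 / c t - 1.
    have mc : 0 < m t ^+ 2 / c t by rewrite divr_gt0 ?exprn_gt0.
    exact: mul_lnB_le ler01 (ltW mc) (fun=> mc).
  have E1 : ln (x t / m t) = ln (x t) - ln (m t) by rewrite ln_div.
  have E2 : ln (m t ^+ 2 / c t) = 2 * ln (m t) - ln (c t).
    by rewrite ln_div ?posrE ?exprn_gt0 // lnXn // mulr_natl.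
  move: H1 H2; rewrite E1 E2 ln1 (ln_sqrt2 (h0 t)) -/(x t).
  lra.
rewrite -(sum_cexp_mul f dE); last first.
  by move=> t s ts; rewrite (mI _ _ ts) (cI _ _ ts).
rewrite -big_split mulr_sumr; apply: ler_sum => t _ /=.
rewrite -[_ * cexp d f t * _]mulrA -mulrDr [X in _ <= X]mulrCA.
have [->|/ltW_neq0 lt] := eqVneq (lam t) 0; first by rewrite !mul0r.
rewrite ler_wpM2l //.
have hx : h t = x t ^+ 2 by rewrite sqr_sqrtr.
have cm : c t * (m t ^+ 2 / c t) <= m t ^+ 2.
  have [->|H] := eqVneq (c t) 0; first by rewrite mul0r sqr_ge0.
  by rewrite mulrC divfK.
have H := xm _ lt.
have := m0 t; rewrite le_eqVlt => /predU1P[me|mt].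
  have xe : x t = 0.
    apply/eqP; rewrite eq_le x0 andbT -(pmulr_rle0 _ p0); lra.
  by rewrite -/(c t) hx; move: cm; rewrite -me xe expr0n /=; lra.
(* This is a factorisation of [2 x ^+ 3 / m - 3 x ^+ 2 + m ^+ 2]; as [x / m <= 1 / p] and [p <= 1],
   the last factor is at most [3 / p]. *)
apply: le_trans (_ : (x t - m t) ^+ 2 * ((2 * x t + m t) / m t) <= _).
  apply: le_trans (lerD (lexx _) cm) _; rewrite hx.
  by rewrite le_eqVlt; apply/orP; left; apply/eqP; field; lra.
rewrite mulrC ler_wpM2r ?sqr_ge0 // ler_pdivrMr // mulrAC ler_pdivlMr //.
have : 0 <= m t * (1 - p) by rewrite mulr_ge0 // subr_ge0.
lra.
Qed.

(* The triangle inequality in each class of [e], through the conditional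
   expectation of [sqrt f]. *)
Lemma var_sqrt_retract e f (r : W -> W) (M : R) : equivalence_rel e ->
    (forall t, 0 <= f t) -> (forall t, e t (r t)) ->
    (forall phi : W -> R, (forall t, 0 <= phi t) ->
       \sum_t lam t * phi (r t) <= M * \sum_t lam t * phi t) ->
  \sum_t lam t * (Num.sqrt (cexp e f t) - Num.sqrt (f (r t))) ^+ 2 <=
    2 * (1 + M) *
      \sum_t lam t * (Num.sqrt (f t) - cexp e (fun s => Num.sqrt (f s)) t) ^+ 2.
Proof.
move=> eE f0 er rM; set y := fun s => Num.sqrt (f s); pose z := cexp e y.
pose x t := Num.sqrt (cexp e f t).
have z0 t : 0 <= z t by apply: cexp_ge0 => s; apply: sqrtr_ge0.
have x0 t : 0 <= x t by apply: sqrtr_ge0.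
have zI t s : e t s -> z t = z s by move=> ts; apply: cexp_inv.
have S1 := sum_cexp f eE; have S3 := sum_cexp_mul y eE zI.
have HM := rM (fun t => (y t - z t) ^+ 2) (fun t => sqr_ge0 _).
(* Jensen's inequality, read off from the nonnegative variance of [y] on a class of [e]. *)
have zx t : 0 < lam t -> z t <= x t.
  move=> lt; rewrite -(ler_pXn2r (n := 2)) ?nnegrE // sqr_sqrtr ?cexp_ge0 //.
  have Pe := mass_gt0 eE lam_ge0 lt.
  rewrite -(ler_pM2r Pe) cexp_mass // -subr_ge0.
  have zE : mass e (fun s => lam s * y s) t = z t * mass e lam t by rewrite cexp_mass.
  rewrite (_ : _ - _ = mass e (fun s => lam s * (y s - z t) ^+ 2) t).
    by apply: mass_ge0 => s; rewrite mulr_ge0 ?sqr_ge0.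
  rewrite (_ : mass e (fun s => lam s * (y s - z t) ^+ 2) t =
     mass e (fun s => lam s * f s) t - 2 * z t * mass e (fun s => lam s * y s) t +
     z t ^+ 2 * mass e lam t); first by rewrite zE; ring.
  rewrite /mass !mulr_sumr -sumrB -big_split; apply: eq_bigr => s _ /=.
  by rewrite -[f s]sqr_sqrtr // -/(y s); ring.
have Hx : \sum_t lam t * (x t - z t) ^+ 2 <= \sum_t lam t * (y t - z t) ^+ 2.
  have -> : \sum_t lam t * (y t - z t) ^+ 2 =
      \sum_t lam t * f t - 2 * \sum_t lam t * y t * z t +
      \sum_t lam t * z t * z t.
    rewrite mulr_sumr -sumrB -big_split; apply: eq_bigr => t _ /=.
    by rewrite -[f t]sqr_sqrtr // -/(y t); ring.
  have -> : \sum_t lam t * f t - 2 * \sum_t lam t * y t * z t +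
      \sum_t lam t * z t * z t = \sum_t lam t * (x t ^+ 2 - z t ^+ 2).
    transitivity (\sum_t lam t * cexp e f t - \sum_t lam t * z t * z t).
      by rewrite -/z in S3; lra.
    rewrite -sumrB; apply: eq_bigr => t _ /=.
    by rewrite /x sqr_sqrtr ?cexp_ge0 //; ring.
  apply: ler_sum => t _; have [->|/ltW_neq0 lt] := eqVneq (lam t) 0.
    by rewrite !mul0r.
  rewrite ler_wpM2l //.
  have : 0 <= z t * (x t - z t) by rewrite mulr_ge0 // subr_ge0 zx.
  lra.
(* Since [r] preserves the classes of [e], [z] agrees at [t] and [r t]; [HM] then removes [r] at the
   cost of [M]. *)
apply: le_trans (_ : 2 * \sum_t lam t * (x t - z t) ^+ 2 +
   2 * \sum_t lam t * (y (r t) - z (r t)) ^+ 2 <= _); last by rewrite -/z; lra.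
rewrite !mulr_sumr -big_split; apply: ler_sum => t _ /=.
rewrite -(zI _ _ (er t)) -/(y (r t)) -/(x t).
have := lam_ge0 t; move: (lam t) (x t) (y _) (z t) => l a b c l0.
have : 0 <= l * (a + b - 2 * c) ^+ 2 by rewrite mulr_ge0 ?sqr_ge0.
lra.
Qed.

(* Abstract form of the star estimate: [e] fixes the configuration off a star
   and the spin at its centre, [d] forgets that spin, [o] resamples it alone,
   and [r] closes all the edges of the star. *)
Lemma loge_star e d o f (r : W -> W) (p M : R) :
    equivalence_rel e -> equivalence_rel d -> equivalence_rel o ->
    subrel e d -> (forall t, 0 <= f t) ->
    0 < p -> p <= 1 -> (forall t, p * mass d lam t <= mass e lam t) ->
    0 <= M -> (forall t, e t (r t)) -> (forall t s, d t s -> o (r t) (r s)) ->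
    (forall phi : W -> R, (forall t, 0 <= phi t) ->
       \sum_t lam t * phi (r t) <= M * \sum_t lam t * phi t) ->
  loge e f - loge d f <= 3 / p * (4 * (1 + M) * (loge eq_op f - loge e f) +
                                  2 * M * (loge eq_op f - loge o f)).
Proof.
move=> eE dE oE ed f0 p0 p1 pP M0 er dor rM.
(* The average over the centre spin alone, taken after closing the star, depends only on the class
   of [d]. *)
pose y s := Num.sqrt (f s); pose k t := cexp o y (r t).
have kI t s : d t s -> k t = k s by move=> /dor ts; apply: cexp_inv.
apply: le_trans (loge_le_var eE dE ed f0 kI p0 p1 pP) _.
apply: ler_wpM2l; first by rewrite divr_ge0 // ltW.
have H1 := var_sqrt_retract eE f0 er rM.
have H2 := var_sqrt_le_loge eE f0.
have H3 := var_sqrt_le_loge oE f0.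
have H4 := rM (fun t => (y t - cexp o y t) ^+ 2) (fun t => sqr_ge0 _).
(* Triangle inequality through [sqrt (f (r t))]: the first term goes to [H1], the second to [H4] and
   [H3]. *)
apply: le_trans (_ : 2 * \sum_t lam t * (Num.sqrt (cexp e f t) - Num.sqrt (f (r t))) ^+ 2 +
   2 * \sum_t lam t * (y (r t) - cexp o y (r t)) ^+ 2 <= _).
  rewrite !mulr_sumr -big_split; apply: ler_sum => t _ /=.
  have := lam_ge0 t; rewrite -/(k t) -/(y (r t)).
  move: (lam t) (Num.sqrt _) (y _) (k t) => l a b c l0.
  have : 0 <= l * (a - 2 * b + c) ^+ 2 by rewrite mulr_ge0 ?sqr_ge0.
  lra.
have H5 := ler_wpM2l (_ : 0 <= 4 * (1 + M)) H2.
have H6 := ler_wpM2l (_ : 0 <= 2 * M) H3.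
have := H5 ltac:(lra); have := H6 ltac:(lra); rewrite -/y; lra.
Qed.

End Weight.
End CondExp.

(** * Image measures and marginals *)

Section Pushforward.
Context {R : realType} {W Y : finType}.
Variable phi : W -> Y.
Implicit Types (h : W -> R) (g : Y -> R).

Definition push h (y : Y) : R := \sum_t (phi t == y)%:R * h t.

Lemma sum_push_mul h g : \sum_y push h y * g y = \sum_t h t * g (phi t).
Proof.
under eq_bigr do rewrite mulr_suml.
rewrite exchange_big /=; apply: eq_bigr => t _.
rewrite (bigD1 (phi t)) //= eqxx mul1r big1 ?addr0 // => y yt.
by rewrite eq_sym (negbTE yt) !mul0r.
Qed.

Lemma push_mulr h g y : push h y * g y = push (fun t => h t * g (phi t)) y.
Proof.
rewrite /push mulr_suml; apply: eq_bigr => t _; rewrite mulrA.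
by case: eqP => [->|_]; rewrite ?mul0r.
Qed.

Lemma sum_push h : \sum_y push h y = \sum_t h t.
Proof.
have := sum_push_mul h (fun=> 1); under eq_bigr do rewrite mulr1.
by move=> ->; apply: eq_bigr => t _; rewrite mulr1.
Qed.

(** Images preserve the total mass, so marginals can be identified from unnormalised weights. *)
Lemma normalise_push h g : (forall y, g y = push h y) ->
  forall y, normalise g y = push (normalise h) y.
Proof.
move=> gE y; rewrite /normalise (eq_bigr _ (fun y _ => gE y)) sum_push gE.
by rewrite mulr_suml; apply: eq_bigr => t _; rewrite mulrA.
Qed.

Lemma mass_push (a : rel Y) h g t : (forall y, g y = push h y) ->
  mass a g (phi t) = mass (fun s t => a (phi s) (phi t)) h t.
Proof.
move=> gE; transitivity (\sum_y push h y * (a (phi t) y)%:R).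
  by apply: eq_bigr => y _; rewrite gE mulrC.
by rewrite sum_push_mul; apply: eq_bigr => s _; rewrite mulrC.
Qed.

(** Stating the second hypothesis for the product covers two uses: [f'] a conditional expectation of
    [f], and [f] a pullback of [f']. *)
Lemma loge_push (a : rel Y) lam f lam' f' :
    (forall y, lam' y = push lam y) ->
    (forall y, lam' y * f' y = push (fun t => lam t * f t) y) ->
  loge lam' a f' = loge lam (fun s t => a (phi s) (phi t)) f.
Proof.
move=> lamE fE; rewrite /loge; under eq_bigr do rewrite fE.
rewrite sum_push_mul; apply: eq_bigr => t _; congr (_ * ln _).
by rewrite /cexp (mass_push a t lamE) (mass_push a t fE).
Qed.

End Pushforward.

(** * Agreement relations on joint configurations *)

Section JointAgreement.
Variables (G : sgraph) (q : nat).
Local Notation config := (joint_config G q).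
Implicit Types (U : {set G}) (S : {set edge G}) (t u : config).

Definition spin_agree U (s s' : spin_config G q) :=
  [forall v, (v \notin U) ==> (s v == s' v)].

(** [U] and [S] list the forgotten coordinates, so enlarging them coarsens the relation. The joint
    model and both marginals only need relations of this form. *)
Definition agree U S : rel config := fun t u =>
  spin_agree U t.1 u.1 && [forall e, (e \notin S) ==> (t.2 e == u.2 e)].

Lemma spin_agreeP U (s s' : spin_config G q) :
  reflect (forall v, v \notin U -> s v = s' v) (spin_agree U s s').
Proof.
apply: (iffP forallP) => H v; first by move=> vU; have := H v; rewrite vU => /eqP.
by apply/implyP => /H ->.
Qed.

Lemma agreeP U S t u : reflect
  ((forall v, v \notin U -> t.1 v = u.1 v) /\
   (forall e, e \notin S -> t.2 e = u.2 e)) (agree U S t u).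
Proof.
apply: (iffP andP) => [[/spin_agreeP H1 /forallP H2]|[H1 H2]]; split => //.
- by move=> e eS; have := H2 e; rewrite eS => /eqP.
- exact/spin_agreeP.
by apply/forallP => e; apply/implyP => /H2 ->.
Qed.

Lemma agree_equiv U S : equivalence_rel (agree U S).
Proof.
apply/equivalence_relP; split; first by move=> t; apply/agreeP.
move=> t u /agreeP[H1 H2] x; apply/agreeP/agreeP => -[H3 H4]; split => y yn.
- by rewrite -H1 ?H3.
- by rewrite -H2 ?H4.
- by rewrite H1 ?H3.
- by rewrite H2 ?H4.
Qed.

Lemma agreeS U S U' S' : U \subset U' -> S \subset S' ->
  subrel (agree U S) (agree U' S').
Proof.
move=> UU SS t u /agreeP[H1 H2]; apply/agreeP; split => y yn.
  by apply: H1; apply: contra yn; apply/subsetP.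
by apply: H2; apply: contra yn; apply/subsetP.
Qed.

Lemma agreeI U S U' S' t u :
  agree (U :&: U') (S :&: S') t u = agree U S t u && agree U' S' t u.
Proof.
apply/idP/andP => [H|[/agreeP[H1 H2] /agreeP[H3 H4]]].
  by split; apply: agreeS H; rewrite ?subsetIl ?subsetIr.
apply/agreeP; split => y; rewrite inE negb_and => /orP[] yn; auto.
Qed.

Lemma agree0 : agree set0 set0 =2 eq_op.
Proof.
move=> t u; apply/agreeP/eqP => [[H1 H2]|-> //].
case: t u H1 H2 => [s A] [s' A'] /= H1 H2.
by congr pair; apply/ffunP => y; [apply: H1|apply: H2]; rewrite inE.
Qed.

Lemma agreeT : agree setT setT =2 (fun _ _ => true).
Proof. by move=> t u; apply/agreeP; split => y; rewrite inE. Qed.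

Lemma agree_vertexE v : agree_off_vertex v =2 agree [set v] set0.
Proof.
move=> t u; apply/andP/agreeP => [[/forallP H /eqP H2]|[H1 H2]]; split.
- by move=> y; rewrite inE => yv; have := H y; rewrite yv => /eqP.
- by rewrite H2.
- by apply/forallP => y; apply/implyP => yv; rewrite H1 // inE.
by apply/eqP/ffunP => e; rewrite H2 // inE.
Qed.

Lemma agree_edgeE e : agree_off_edge e =2 agree set0 [set e].
Proof.
move=> t u; apply/andP/agreeP => [[/eqP H /forallP H2]|[H1 H2]]; split.
- by rewrite H.
- by move=> y; rewrite inE => yv; have := H2 y; rewrite yv => /eqP.
- by apply/eqP/ffunP => y; rewrite H1 // inE.
by apply/forallP => y; apply/implyP => yv; rewrite H2 // inE.
Qed.

Lemma agree_spinE v :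
  (fun t u : config => agree_off v t.1 u.1) =2 agree [set v] setT.
Proof.
move=> t u; apply/forallP/agreeP => [H|[H _] y].
  split=> y; rewrite inE // => yv; have := H y; rewrite yv => /eqP //.
by apply/implyP => yv; rewrite H // inE.
Qed.

Lemma agree_all_edgesE : (fun t u : config => t.1 == u.1) =2 agree set0 setT.
Proof.
move=> t u; apply/eqP/agreeP => [->|[H _]]; first by split=> // y; rewrite inE.
by apply/ffunP => y; rewrite H // inE.
Qed.

Lemma agree_all_spinsE : (fun t u : config => t.2 == u.2) =2 agree setT set0.
Proof.
move=> t u; apply/eqP/agreeP => [->|[_ H]]; first by split=> // y; rewrite inE.
by apply/ffunP => y; rewrite H // inE.
Qed.

Lemma agree_rcE e :
  (fun t u : config => agree_off e t.2 u.2) =2 agree setT [set e].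
Proof.
move=> t u; apply/forallP/agreeP => [H|[_ H] y].
  split=> y; rewrite inE // => yv; have := H y; rewrite yv => /eqP //.
by apply/implyP => yv; rewrite H // inE.
Qed.

End JointAgreement.

Lemma agree_off_equiv (X S : finType) (x : X) :
  equivalence_rel (@agree_off X S x).
Proof.
have P (s t : {ffun X -> S}) : reflect (forall y, y != x -> s y = t y) (@agree_off X S x s t).
  apply: (iffP forallP) => H y; first by move=> yx; have := H y; rewrite yx => /eqP.
  by apply/implyP => /H ->.
apply/equivalence_relP; split=> [s|s t /P H u]; first exact/P.
by apply/P/P => H' y yx; rewrite -?H' ?H // -H.
Qed.

(** * Edge weights given the spins *)

Section EdwardsSokal.
Variables (R : realType) (G : sgraph) (q : nat) (beta : R).
Hypothesis beta_gt0 : 0 < beta.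
Local Notation config := (joint_config G q).
Local Notation spins := (spin_config G q).
Implicit Types (U : {set G}) (S : {set edge G}) (t u : config) (s : spins).

Definition es_weight t : R := (expR beta - 1) ^+ #|open_edges t.2| *
  (open_edges t.2 \subset mono_edges t.1)%:R.

Definition edge_weight s (e : edge G) (b : bool) : R :=
  if b then (expR beta - 1) * (e \in mono_edges s)%:R else 1.

Definition edge_total s (e : edge G) : R :=
  if e \in mono_edges s then expR beta else 1.

Lemma expR_beta_gt1 : 1 < expR beta.
Proof. by rewrite expR_gt1. Qed.

Lemma edge_weight_ge0 s e b : 0 <= edge_weight s e b.
Proof.
by rewrite /edge_weight; case: b => //; rewrite mulr_ge0 // subr_ge0 ltW ?expR_beta_gt1.
Qed.

Lemma edge_total_ge1 s e : 1 <= edge_total s e.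
Proof. by rewrite /edge_total; case: ifP => _ //; rewrite ltW ?expR_beta_gt1. Qed.

Lemma edge_total_le s e : edge_total s e <= expR beta.
Proof. by rewrite /edge_total; case: ifP => _ //; rewrite ltW ?expR_beta_gt1. Qed.

Lemma edge_totalE s e :
  \sum_(b : bool) edge_weight s e b = edge_total s e.
Proof.
rewrite big_bool /edge_weight /edge_total.
by case: (e \in _) => /=; ring.
Qed.

(** The inclusion indicator is a product over the open edges; hence the edges are independent given
    the spins. *)
Lemma es_weightE t : es_weight t = \prod_e edge_weight t.1 e (t.2 e).
Proof.
rewrite /es_weight /edge_weight -big_mkcond big_split /= prodr_const.
congr (_ * _).
  by congr (_ ^+ _); apply: eq_card => e; rewrite !inE.
case: (boolP (_ \subset _)) => [/subsetP sub|/subsetPn[e eo em]].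
  by rewrite big1 // => e te; rewrite sub ?inE.
rewrite (bigD1 e) /=; first by rewrite (negbTE em) mul0r.
by move: eo; rewrite inE.
Qed.

Definition fibre_weight S s (A : edge_config G) : R :=
  \prod_e (if e \in S then edge_total s e else edge_weight s e (A e)).

Lemma sum_joint (h : config -> R) : \sum_t h t = \sum_s \sum_A h (s, A).
Proof. by rewrite pair_bigA; apply: eq_bigr => -[]. Qed.

(** The constraint off [S] is itself a product over edges, so the sum of products factorises. *)
Lemma sum_edge_config S s (A : edge_config G) :
  \sum_(A' : edge_config G)
    [forall e, (e \notin S) ==> (A e == A' e)]%:R * es_weight (s, A') =
    fibre_weight S s A.
Proof.
pose F (e : edge G) (b : bool) :=
  (if e \in S then 1 else (A e == b)%:R) * edge_weight s e b.
transitivity (\prod_e \sum_(b : bool) F e b); last first.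
  apply: eq_bigr => e _; rewrite /F; case: ifP => _.
    by rewrite -edge_totalE; apply: eq_bigr => b _; rewrite mul1r.
  by rewrite big_bool; case: (A e) => /=; rewrite mul1r mul0r ?addr0 ?add0r.
rewrite bigA_distr_bigA; apply: eq_bigr => A' _.
rewrite /F big_split es_weightE /=; congr (_ * _).
case: (boolP [forall _, _]) => [/forallP H|/forallPn[e]].
  rewrite big1 // => e _; case: ifP => // /negbT eS.
  by have := H e; rewrite eS /= => ->.
rewrite negb_imply => /andP[eS Ae].
by rewrite (bigD1 e) //= (negbTE eS) (negbTE Ae) mul0r.
Qed.

Lemma mass_agree U S t : mass (agree U S) es_weight t =
  \sum_s (spin_agree U t.1 s)%:R * fibre_weight S s t.2.
Proof.
rewrite /mass sum_joint; apply: eq_bigr => s _.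
rewrite -sum_edge_config mulr_sumr; apply: eq_bigr => A _.
by rewrite mulrA -natrM mulnb.
Qed.

Lemma mass_agree_edges S t :
  mass (agree set0 S) es_weight t = fibre_weight S t.1 t.2.
Proof.
rewrite mass_agree (bigD1 t.1) //= big1 ?addr0.
  rewrite (_ : spin_agree _ _ _) ?mul1r //; exact/spin_agreeP.
move=> s st; rewrite (_ : spin_agree _ _ _ = false) ?mul0r //.
apply: contraNF st => /spin_agreeP H; apply/eqP/ffunP => v.
by rewrite H // inE.
Qed.

Lemma es_weight_ge0 t : 0 <= es_weight t.
Proof. by rewrite es_weightE prodr_ge0 // => e _; apply: edge_weight_ge0. Qed.

(** Conditional independence of disjoint edge sets given the spins: each edge contributes the same
    pair of factors to both sides. *)
Lemma fibre_weightU S S' s A : [disjoint S & S'] ->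
  fibre_weight S s A * fibre_weight S' s A =
  fibre_weight (S :|: S') s A * fibre_weight set0 s A.
Proof.
move=> dis; rewrite /fibre_weight -!big_split; apply: eq_bigr => e _ /=.
rewrite !inE; case: (boolP (e \in S)) => [eS|_] //=.
  by rewrite (disjointFr dis eS).
by rewrite mulrC.
Qed.

Definition star_total S s : R := \prod_(e in S) edge_total s e.

Definition outer_weight S s (A : edge_config G) : R :=
  \prod_(e in ~: S) edge_weight s e (A e).

Lemma fibre_weight_split S s A :
  fibre_weight S s A = star_total S s * outer_weight S s A.
Proof.
rewrite /fibre_weight (bigID (mem S)) /=; congr (_ * _).
  by apply: eq_bigr => e ->.
by apply: eq_big => e; rewrite ?inE // => /negbTE ->.
Qed.

Lemma star_total_split S S' s : S \subset S' ->
  star_total S' s = star_total S s * star_total (S' :\: S) s.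
Proof.
move=> SS; rewrite /star_total (big_setID S) /=; congr (_ * _).
by rewrite (setIidPr SS).
Qed.

Lemma star_total_ge1 S s : 1 <= star_total S s.
Proof.
rewrite /star_total; elim/big_rec: _ => // e x _ x1.
by rewrite -[1]mulr1 ler_pM // edge_total_ge1.
Qed.

Lemma star_total_le S s : star_total S s <= expR beta ^+ #|S|.
Proof.
rewrite /star_total -prodr_const; apply: ler_prod => e _.
by rewrite edge_total_le (le_trans ler01 (edge_total_ge1 _ _)).
Qed.

Lemma outer_weight_ge0 S s A : 0 <= outer_weight S s A.
Proof. by apply: prodr_ge0 => e _; apply: edge_weight_ge0. Qed.

Lemma star_totalT s : star_total setT s = expR (beta * #|mono_edges s|%:R).
Proof.
rewrite expRM_natr -prodr_const [RHS]big_mkcond /=.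
by apply: eq_big => [e|e _]; rewrite ?in_setT.
Qed.

Lemma es_weight_spin s : \sum_(A : edge_config G) es_weight (s, A) =
  expR (beta * #|mono_edges s|%:R).
Proof.
rewrite -star_totalT -[RHS]mulr1.
(* An empty product, inserted to reach the form of [fibre_weight_split]. *)
have <- : outer_weight setT s [ffun=> false] = 1.
  by rewrite /outer_weight setCT big_set0.
rewrite -fibre_weight_split -sum_edge_config; apply: eq_bigr => A _.
rewrite (_ : [forall _, _]) ?mul1r //.
by apply/forallP => e; rewrite inE.
Qed.

(** * The star of a vertex *)

Definition star (v : G) : {set edge G} := [set e : edge G | v \in val e].

Lemma mono_edges_off_star v s s' (e : edge G) : spin_agree [set v] s s' ->
  e \notin star v -> (e \in mono_edges s) = (e \in mono_edges s').
Proof.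
move=> /spin_agreeP H; rewrite !inE => ve.
have H' (u : G) : u \in val e -> s u = s' u.
  move=> ue; apply: H; rewrite inE; apply: contraNneq ve => <-; exact: ue.
apply: eq_forallb_in => u ue; apply: eq_forallb_in => w we.
by rewrite !H'.
Qed.

Lemma outer_weight_off_star v s s' A : spin_agree [set v] s s' ->
  outer_weight (star v) s A = outer_weight (star v) s' A.
Proof.
move=> ss; apply: eq_bigr => e; rewrite inE => ev.
by rewrite /edge_weight (mono_edges_off_star ss ev).
Qed.

Lemma star_total_off_star v s s' : spin_agree [set v] s s' ->
  star_total (setT :\: star v) s = star_total (setT :\: star v) s'.
Proof.
move=> ss; apply: eq_bigr => e; rewrite inE => /andP[ev _].
by rewrite /edge_total (mono_edges_off_star ss ev).
Qed.

(** Partition function of the star of [v], with the other spins as boundary condition. *)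
Definition centre_total v s : R :=
  \sum_s' (spin_agree [set v] s s')%:R * star_total (star v) s'.

(** Edges off the star do not see the spin at [v], so their weight factors out. *)
Lemma mass_agree_star v t : mass (agree [set v] (star v)) es_weight t =
  centre_total v t.1 * outer_weight (star v) t.1 t.2.
Proof.
rewrite mass_agree /centre_total mulr_suml; apply: eq_bigr => s _.
rewrite fibre_weight_split; case: (boolP (spin_agree _ _ _)) => [ss|_].
  by rewrite (outer_weight_off_star _ ss) mulrA.
by rewrite !mul0r.
Qed.

Lemma mass_agree_centre v t : mass (agree [set v] setT) es_weight t =
  centre_total v t.1 * star_total (setT :\: star v) t.1.
Proof.
rewrite mass_agree /centre_total mulr_suml; apply: eq_bigr => s _.
rewrite fibre_weight_split /outer_weight setCT big_set0 mulr1.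
rewrite (star_total_split _ (subsetT (star v))).
case: (boolP (spin_agree _ _ _)) => [ss|_].
  by rewrite (star_total_off_star ss) mulrA.
by rewrite !mul0r.
Qed.

Lemma card_spin_agree v s : (#|[set s' | spin_agree [set v] s s']| <= q)%N.
Proof.
set A := [set _ | _]; have inj : {in A &, injective (fun s' : spins => s' v)}.
  move=> s1 s2; rewrite !inE => /spin_agreeP H1 /spin_agreeP H2 s12.
  apply/ffunP => u; have [->//|uv] := eqVneq u v.
  by rewrite -H1 ?inE // H2 ?inE.
by rewrite -(card_in_imset inj) (leq_trans (max_card _)) // card_ord.
Qed.

Lemma edge_ends (e : edge G) : exists u w : G, adj u w /\ val e = [set u; w].
Proof.
by case/imsetP: (valP e) => -[u w]; rewrite inE /= => uw ->; exists u, w.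
Qed.

Lemma card_edge (e : edge G) : (#|val e| <= 2)%N.
Proof.
by have [u [w [_ ->]]] := edge_ends e; rewrite cards2; case: (_ != _).
Qed.

(** An edge at [v] is [[set v; u]] for a neighbour [u] of [v]. *)
Lemma card_star v : (#|star v| <= max_degree G)%N.
Proof.
apply: leq_trans (leq_bigmax v); rewrite /degree -(card_imset _ val_inj).
apply: leq_trans (leq_imset_card (fun u : G => [set v; u]) [set u | adj v u]).
apply/subset_leq_card/subsetP => _ /imsetP[e ve ->].
have [u [w [uw eE]]] := edge_ends e.
move: ve; rewrite inE eE !inE => /orP[] /eqP ->.
  by apply/imsetP; exists w; rewrite ?inE.
by apply/imsetP; exists u; rewrite ?inE 1?adj_sym // setUC.
Qed.

Local Notation star_bound := (expR (beta * (max_degree G)%:R)).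

Lemma star_bound_ge1 : 1 <= star_bound.
Proof. by apply: le_trans (expR_ge1Dx _); rewrite lerDl mulr_ge0 // ltW. Qed.

Lemma star_total_bound v s : star_total (star v) s <= star_bound.
Proof.
apply: le_trans (star_total_le _ _) _; rewrite expRM_natr.
by rewrite ler_weXn2l ?card_star // ltW ?expR_beta_gt1.
Qed.

Lemma centre_total_bound v s : centre_total v s <= q%:R * star_bound.
Proof.
apply: (@le_trans _ _ (\sum_(s' in [set s' | spin_agree [set v] s s']) star_bound)).
  rewrite /centre_total [X in _ <= X]big_mkcond; apply: ler_sum => s' _.
  by rewrite inE; case: ifP => _; rewrite ?mul1r ?mul0r // star_total_bound.
rewrite sumr_const -[star_bound *+ _]mulr_natl ler_wpM2r ?ler_nat ?card_spin_agree //.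
by rewrite (le_trans ler01 star_bound_ge1).
Qed.

Definition close_star v t : config :=
  (t.1, [ffun e => t.2 e && (e \notin star v)]).

Lemma agree_close_star v t : agree set0 (star v) t (close_star v t).
Proof. by apply/agreeP; split => // e ev; rewrite ffunE ev andbT. Qed.

Lemma close_star_agree v t u : agree [set v] (star v) t u ->
  agree [set v] set0 (close_star v t) (close_star v u).
Proof.
move=> /agreeP[H1 H2]; apply/agreeP; split => // e _; rewrite !ffunE.
by case: (boolP (e \in star v)) => [_|/H2 ->]; rewrite ?andbF.
Qed.

(** The image of the weight under closing the star has density at most [star_bound]: the mass over a
    closed [u] is the weight of [u] times the total of its star edges. *)
Lemma sum_close_star v (phi : config -> R) : (forall t, 0 <= phi t) ->
  \sum_t es_weight t * phi (close_star v t) <=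
    star_bound * \sum_t es_weight t * phi t.
Proof.
move=> phi0; rewrite -(sum_push_mul (close_star v)) mulr_sumr.
apply: ler_sum => u _; rewrite mulrA ler_wpM2r //.
have M0 : 0 <= star_bound := le_trans ler01 star_bound_ge1.
(* Closing the star is idempotent, so a configuration that it moves has no preimage. *)
have [uE|uE] := eqVneq (close_star v u) u; last first.
  rewrite /push big1; first exact: mulr_ge0 M0 (es_weight_ge0 u).
  move=> t _.
  rewrite (_ : _ == _ = false) ?mul0r //; apply: contraNF uE => /eqP <-.
  apply/eqP; congr pair; apply/ffunP => e; rewrite !ffunE.
  by case: (_ \notin _); rewrite ?andbF ?andbT.
apply: (@le_trans _ _ (mass (agree set0 (star v)) es_weight u)).
  apply: ler_sum => t _; rewrite ler_wpM2r ?es_weight_ge0 // ler_nat.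
  case: eqP => // tu; rewrite (equivalence_sym (@agree_equiv _ _ _ _)) -tu.
  by rewrite agree_close_star.
rewrite mass_agree_edges fibre_weight_split.
apply: (@le_trans _ _ (star_bound * outer_weight (star v) u.1 u.2)).
  by rewrite ler_wpM2r ?outer_weight_ge0 ?star_total_bound.
(* Closed edges have weight 1, so only the edges off the star contribute to the weight of [u]. *)
rewrite ler_wpM2l // es_weightE (bigID (mem (star v))) /=.
rewrite big1 ?mul1r => [|e ev]; last by rewrite -uE ffunE ev andbF.
by rewrite le_eqVlt; apply/orP; left; apply/eqP/eq_bigl => e; rewrite inE.
Qed.

(** * Entropy inequalities for the Edwards-Sokal distribution *)

Hypothesis q_ge2 : (2 <= q)%N.
Local Notation nu := (edwards_sokal G q beta).

Definition spin0 : 'I_q := Ordinal (ltnW q_ge2).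

Lemma sum_es_weight_gt0 : 0 < \sum_t es_weight t.
Proof.
rewrite (bigD1 ([ffun=> spin0], [ffun=> false])) //= ltr_pwDl //.
  rewrite es_weightE; apply: prodr_gt0 => e _.
  by rewrite ffunE /edge_weight ltr01.
by apply: sumr_ge0 => t _; apply: es_weight_ge0.
Qed.

Lemma nuE t : nu t = es_weight t / \sum_u es_weight u.
Proof. by []. Qed.

Lemma nu_ge0 t : 0 <= nu t.
Proof. by rewrite nuE divr_ge0 ?es_weight_ge0 // ltW ?sum_es_weight_gt0. Qed.

Lemma sum_nu : \sum_t nu t = 1.
Proof.
under eq_bigr do rewrite nuE.
by rewrite -mulr_suml divff // gt_eqF // sum_es_weight_gt0.
Qed.

Lemma mass_nu e t : mass e nu t = mass e es_weight t / \sum_u es_weight u.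
Proof.
by rewrite /mass mulr_suml; apply: eq_bigr => s _; rewrite nuE mulrA.
Qed.

Local Notation L := (loge nu).

(** The independence identity can be checked on unnormalised weights, since both sides contain two
    masses. *)
Lemma agree_submod U S U' S' g :
    (forall t, mass (agree U S) es_weight t * mass (agree U' S') es_weight t =
       mass (agree (U :|: U') (S :|: S')) es_weight t *
       mass (agree (U :&: U') (S :&: S')) es_weight t) ->
    (forall t, 0 <= g t) ->
  L (agree U S) g + L (agree U' S') g <=
    L (agree (U :&: U') (S :&: S')) g + L (agree (U :|: U') (S :|: S')) g.
Proof.
move=> indep g0; apply: (loge_submod nu_ge0) => //; try exact: agree_equiv.
- by apply: agreeS; apply: subsetUl.
- by apply: agreeS; apply: subsetUr.
- exact: agreeI.
by move=> t; rewrite !mass_nu mulrACA indep mulrACA.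
Qed.

Lemma loge_id g : L eq_op g = L (agree set0 set0) g.
Proof. by apply: eq_loge => t u; rewrite agree0. Qed.

(** Induction on [S]: submodularity for [S :\ e] and [[set e]], whose intersection is empty, splits
    off one edge. *)
Lemma edge_tensorisation g S : (forall t, 0 <= g t) ->
  L eq_op g - L (agree set0 S) g <=
    \sum_(e in S) (L eq_op g - L (agree set0 [set e]) g).
Proof.
move=> g0; have [n] := ubnP #|S|; elim: n S => // n IH S Sn.
have [->|[e eS]] := set_0Vmem S; first by rewrite big_set0 -loge_id subrr.
rewrite (big_setD1 e) //=.
have lt : (#|S :\ e| < n)%N by move: Sn; rewrite (cardsD1 e) eS.
have dis : [disjoint S :\ e & [set e]] by rewrite -setI_eq0 setIDAC setDIl setDv setI0.
have := @agree_submod set0 (S :\ e) set0 [set e] g.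
rewrite !setI0 setU0 setUC setD1K //.
rewrite (_ : (S :\ e) :&: [set e] = set0); last by apply/eqP; rewrite setI_eq0.
rewrite -loge_id => H; have := H _ g0; have := IH _ lt.
suff HH t : mass (agree set0 (S :\ e)) es_weight t * mass (agree set0 [set e]) es_weight t =
   mass (agree set0 S) es_weight t * mass (agree set0 set0) es_weight t.
  by move=> H1 H2; have := H2 HH; lra.
by rewrite !mass_agree_edges fibre_weightU // setUC setD1K.
Qed.

(** Given the spins off [v], the spin at [v] is independent of the edges off the star, so revealing
    these edges can only increase the entropy difference. *)
Lemma centre_submod v g : (forall t, 0 <= g t) ->
  L (agree set0 setT) g - L (agree [set v] setT) g <=
    L (agree set0 (star v)) g - L (agree [set v] (star v)) g.
Proof.
move=> g0; have := @agree_submod set0 setT [set v] (star v) g.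
rewrite set0I set0U setTI setTU => H.
suff HH t : mass (agree set0 setT) es_weight t * mass (agree [set v] (star v)) es_weight t =
   mass (agree [set v] setT) es_weight t * mass (agree set0 (star v)) es_weight t.
  by have := H HH g0; lra.
rewrite mass_agree_star mass_agree_centre !mass_agree_edges !fibre_weight_split.
rewrite (star_total_split _ (subsetT (star v))) /outer_weight setCT big_set0; ring.
Qed.

Lemma star_estimate v g : (forall t, 0 <= g t) ->
  L (agree set0 (star v)) g - L (agree [set v] (star v)) g <=
    24 * q%:R * star_bound ^+ 2 * ((L eq_op g - L (agree set0 (star v)) g) +
                                   (L eq_op g - L (agree [set v] set0) g)).
Proof.
move=> g0; have M1 := star_bound_ge1; have Z0 := sum_es_weight_gt0.
have q1 : 1 <= q%:R :> R by rewrite ler1n ltnW.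
have qM1 : 1 <= q%:R * star_bound by rewrite mulr_ege1.
have E := @agree_equiv G q.
have Le U S : 0 <= L eq_op g - L (agree U S) g.
  rewrite subr_ge0 loge_id; apply: (loge_mono nu_ge0) => //.
  by apply: agreeS; apply: sub0set.
have sub : subrel (agree set0 (star v)) (@agree G q [set v] (star v)).
  by apply: agreeS => //; apply: sub0set.
have := @loge_star _ _ nu nu_ge0 _ _ _ g (close_star v)
  (q%:R * star_bound)^-1 star_bound (E set0 (star v)) (E [set v] (star v))
  (E [set v] set0) sub g0.
move=> H; apply: le_trans (H _ _ _ _ _ _ _) _.
- by rewrite invr_gt0; lra.
- by rewrite invf_le1 //; lra.
(* The common outer weight cancels. What remains is at least 1 when the spin at [v] is fixed and at
   most [q * star_bound] when it is summed out. *)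
- move=> t; rewrite mulrC ler_pdivrMr; last lra.
  rewrite !mass_nu mulrAC ler_wpM2r ?invr_ge0 ?(ltW Z0) //.
  rewrite mass_agree_star mass_agree_edges fibre_weight_split mulrAC.
  rewrite ler_wpM2r ?outer_weight_ge0 //.
  apply: le_trans (centre_total_bound _ _) _.
  by rewrite ler_peMl ?star_total_ge1 //; lra.
- lra.
- exact: agree_close_star.
- exact: close_star_agree.
- move=> phi phi0; have := sum_close_star v phi0.
  have nuS (h : config -> R) :
      \sum_t nu t * h t = (\sum_t es_weight t * h t) / \sum_u es_weight u.
    by rewrite mulr_suml; apply: eq_bigr => t _; rewrite nuE mulrAC.
  by rewrite (nuS (fun t => phi (close_star v t))) nuS mulrA ler_pM2r ?invr_gt0.
rewrite invrK.
move: (Le set0 (star v)) (Le [set v] set0).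
move: (L eq_op g - _) (L eq_op g - _) => Y X X0 Y0.
(* As [star_bound >= 1], both [4 * (1 + M)] and [2 * M] with [M = star_bound] are at most [8 * M],
   and 3 times 8 is 24. *)
apply: (@le_trans _ _ (3 * (q%:R * star_bound) * (8 * star_bound * (X + Y)))).
  apply: ler_wpM2l; first by lra.
  have : 0 <= (star_bound - 1) * X by rewrite mulr_ge0 // subr_ge0.
  have : 0 <= star_bound * Y by rewrite mulr_ge0 //; lra.
  lra.
by rewrite le_eqVlt; apply/orP; left; apply/eqP; ring.
Qed.

(** Double counting: an edge lies in the stars of its endpoints only. *)
Lemma sum_star (x : edge G -> R) : (forall e, 0 <= x e) ->
  \sum_(v : G) \sum_(e in star v) x e <= 2 * \sum_e x e.
Proof.
move=> x0; rewrite (exchange_big_dep xpredT) //= mulr_sumr.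
apply: ler_sum => e _; rewrite sumr_const -[x e *+ _]mulr_natl ler_wpM2r // ler_nat.
rewrite (eq_card (_ : _ =i val e)) ?card_edge //.
by move=> v; transitivity (e \in star v) => //; rewrite inE.
Qed.

(** The entropy is split at [agree set0 setT]. The constant 49 is 48 from the spin part, 24 doubled
    by counting each edge at both ends, plus 1 from the edge part. *)
Lemma joint_factorisation (C : R) g : 1 <= C -> (forall t, 0 <= g t) ->
    L (agree set0 setT) g - L (agree setT setT) g <=
      C * \sum_(v : G) (L (agree set0 setT) g - L (agree [set v] setT) g) ->
  L eq_op g - L (agree setT setT) g <=
    49 * (q%:R ^+ 3 * expR (3 * beta * (max_degree G)%:R) * C) *
     (\sum_(v : G) (L eq_op g - L (agree [set v] set0) g) +
      \sum_e (L eq_op g - L (agree set0 [set e]) g)).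
Proof.
move=> C1 g0 spinC.
have M1 := star_bound_ge1.
have q1 : 1 <= q%:R :> R by rewrite ler1n ltnW.
have Le U S : 0 <= L eq_op g - L (agree U S) g.
  rewrite subr_ge0 loge_id; apply: (loge_mono nu_ge0) => //; try exact: agree_equiv.
  by apply: agreeS; apply: sub0set.
set SV := \sum_v (L eq_op g - _); set SE := \sum_e _.
have SV0 : 0 <= SV by apply: sumr_ge0.
have SE0 : 0 <= SE by apply: sumr_ge0.
have edges : L eq_op g - L (agree set0 setT) g <= SE.
  apply: le_trans (edge_tensorisation _ g0) _.
  by rewrite le_eqVlt; apply/orP; left; apply/eqP/eq_bigl => e; rewrite inE.
have D0 : 0 <= 24 * q%:R * star_bound ^+ 2 by rewrite !mulr_ge0 //; lra.
have spins : \sum_(v : G) (L (agree set0 setT) g - L (agree [set v] setT) g) <=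
    24 * q%:R * star_bound ^+ 2 * (2 * SE + SV).
  apply: (@le_trans _ _ (24 * q%:R * star_bound ^+ 2 *
     (\sum_(v : G) \sum_(e in star v) (L eq_op g - L (agree set0 [set e]) g) + SV))).
    rewrite -big_split mulr_sumr; apply: ler_sum => v _.
    apply: le_trans (centre_submod v g0) _.
    apply: le_trans (star_estimate v g0) _.
    by apply: ler_wpM2l => //; rewrite lerD2r edge_tensorisation.
  by apply: ler_wpM2l => //; rewrite lerD2r sum_star.
have {}spinC := le_trans spinC (ler_wpM2l (le_trans ler01 C1) spins).
have -> : expR (3 * beta * (max_degree G)%:R) = star_bound ^+ 3.
  by rewrite -expRM_natr; congr expR; ring.
move: star_bound M1 D0 spins spinC => M M1 D0 _ spinC.
(* The argument yields [q * M ^+ 2], which is weakened to the announced powers. *)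
have qM : q%:R * M ^+ 2 <= q%:R ^+ 3 * M ^+ 3.
  rewrite ler_pM //; try by rewrite ?exprn_ge0 //; lra.
    by rewrite -[X in X <= _]expr1 ler_weXn2l.
  by rewrite ler_weXn2l.
have B1 : 1 <= q%:R ^+ 3 * M ^+ 3 by rewrite mulr_ege1 // exprn_ege1.
set B := q%:R ^+ 3 * M ^+ 3 in qM B1 *.
have BC1 : 1 <= B * C by rewrite mulr_ege1.
have H1 : C * (24 * q%:R * M ^+ 2 * (2 * SE + SV)) <= 48 * (B * C) * (SE + SV).
  apply: (@le_trans _ _ ((q%:R * M ^+ 2) * (C * (48 * SE + 24 * SV)))).
    by rewrite le_eqVlt; apply/orP; left; apply/eqP; ring.
  apply: (@le_trans _ _ (B * (C * (48 * (SE + SV))))); last first.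
    by rewrite le_eqVlt; apply/orP; left; apply/eqP; ring.
  apply: ler_pM => //; rewrite ?mulr_ge0 ?exprn_ge0 //; try lra.
  by apply: ler_wpM2l; lra.
(* Here [1 <= C] absorbs the constant 1 of the edge part. *)
have H2 : SE <= B * C * (SE + SV).
  apply: (@le_trans _ _ (1 * (SE + SV))); first lra.
  by apply: ler_wpM2r => //; lra.
lra.
Qed.

(** * The Potts and random-cluster marginals *)

Lemma push_fst (h : config -> R) s : push fst h s = \sum_A h (s, A).
Proof.
rewrite /push sum_joint (bigD1 s) //= [X in _ + X]big1 ?addr0.
  by apply: eq_bigr => A _; rewrite eqxx mul1r.
by move=> s' ss; rewrite big1 // => A _; rewrite (negbTE ss) mul0r.
Qed.

Lemma push_snd (h : config -> R) A : push snd h A = \sum_s h (s, A).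
Proof.
rewrite /push sum_joint; apply: eq_bigr => s _.
rewrite (bigD1 A) //= eqxx mul1r big1 ?addr0 // => A' AA.
by rewrite (negbTE AA) mul0r.
Qed.

Lemma pottsE s : potts G q beta s = push fst nu s.
Proof. by apply: normalise_push => s'; rewrite push_fst es_weight_spin. Qed.

Lemma subset_mono_edgesP (A : edge_config G) s : reflect
  (forall u w : G, connect (open_rel A) u w -> s u = s w)
  (open_edges A \subset mono_edges s).
Proof.
apply: (iffP subsetP) => [sub u w|con e eo].
  case/connectP => p; elim: p u => [|x p IH] u /= => [_ -> //|/andP[ux xp] wE].
  rewrite -(IH x) //; case/existsP: ux => e /andP[/sub eo /eqP ee].
  move: eo; rewrite inE => /forall_inP/(_ u); rewrite ee set21 => /(_ isT).
  by move=> /forall_inP/(_ x); rewrite set22 => /(_ isT)/eqP.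
have [u [w [_ ee]]] := edge_ends e.
have ouw x y : val e = [set x; y] -> s x = s y.
  by move=> exy; apply/con/connect1/existsP; exists e; rewrite eo exy /=.
rewrite inE; apply/forall_inP => x xe; apply/forall_inP => y ye; apply/eqP.
move: xe ye; rewrite ee !inE => /orP[]/eqP-> /orP[]/eqP-> //; first exact: ouw.
by apply: ouw; rewrite setUC.
Qed.

(** Compatible spins are constant on components, hence correspond to free choices at the component
    roots. *)
Lemma card_mono_spins (A : edge_config G) :
  #|[set s : spins | open_edges A \subset mono_edges s]| =
    (q ^ num_components A)%N.
Proof.
have sym : connect_sym (open_rel A).
  by apply: sym_connect_sym => u w; apply: eq_existsb => e; rewrite setUC.
pose I : finType := {x : G | x \in roots (open_rel A)}.
have rootI (u : G) : fingraph.root (open_rel A) u \in roots (open_rel A) by apply: roots_root.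
pose root_of (u : G) : I := exist (fun x => x \in roots (open_rel A)) _ (rootI u).
pose F (rho : {ffun I -> 'I_q}) : spins := [ffun u : G => rho (root_of u)].
have Finj : injective F.
  move=> r1 r2 /ffunP E; apply/ffunP => x; have := E (val x); rewrite !ffunE.
  suff -> : root_of (val x) = x by [].
  by apply: val_inj => /=; apply/eqP; exact: (valP x).
transitivity #|F @: [set: {ffun I -> 'I_q}]|; last first.
  rewrite card_imset // cardsT card_ffun card_ord; congr (_ ^ _)%N.
  by rewrite card_sig; apply: eq_card => x; rewrite !inE andbT.
apply: eq_card => s; rewrite inE; apply/subset_mono_edgesP/imsetP => [con|].
  exists [ffun x : I => s (val x)]; first by rewrite inE.
  by apply/ffunP => u; rewrite !ffunE /=; apply/con/connect_root.
move=> [rho _ ->] u w /(fingraph.rootP sym) uw; rewrite !ffunE; congr (rho _).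
exact: val_inj.
Qed.

Lemma random_clusterE A : random_cluster G q beta A = push snd nu A.
Proof.
apply: normalise_push => {}A; rewrite push_snd /es_weight /= -mulr_sumr mulrC; congr (_ * _).
rewrite -natrX -card_mono_spins -sumr_const [LHS]big_mkcond /=.
by apply: eq_bigr => s _; rewrite inE; case: ifP.
Qed.

Lemma potts_gt0 s : 0 < potts G q beta s.
Proof.
rewrite /potts /normalise divr_gt0 ?expR_gt0 // (bigD1 s) //=.
by rewrite ltr_pwDl ?expR_gt0 // sumr_ge0 // => s' _; apply/ltW/expR_gt0.
Qed.

Lemma sum_potts : \sum_s potts G q beta s = 1.
Proof. by rewrite (eq_bigr _ (fun s _ => pottsE s)) sum_push sum_nu. Qed.

Lemma sum_random_cluster : \sum_A random_cluster G q beta A = 1.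
Proof. by rewrite (eq_bigr _ (fun A _ => random_clusterE A)) sum_push sum_nu. Qed.

End EdwardsSokal.

(** * Lower bound on the spin constant, and conclusion *)

Lemma eq_equivalence_rel (T : Type) (e e' : rel T) : e =2 e' ->
  equivalence_rel e' -> equivalence_rel e.
Proof. by move=> ee eE x y z; rewrite !ee; apply: eE. Qed.

(* Tested on the indicator function of one value of one coordinate. *)
Lemma entropy_factorisation_ge1 (R : realType) (X S : finType)
    (lam : {ffun X -> S} -> R) (C : R) (x : X) (i j : S) :
    i != j -> (forall s, 0 < lam s) -> \sum_s lam s = 1 ->
  entropy_factorisation lam C -> 1 <= C.
Proof.
move=> ij lam_gt0 lam1 fact.
have lam0 s : 0 <= lam s by apply: ltW.
pose f (s : {ffun X -> S}) : R := (s x == i)%:R.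
have f0 s : 0 <= f s by rewrite ler0n.
have := fact f f0.
have eqE : equivalence_rel (@eq_op {ffun X -> S}).
  by apply: (@eq_equivalence_rel _ _ (fun s t => id s == id t)) => //
    s t u; split=> // /eqP ->.
(* The indicator depends on the coordinate [x] only, so resampling any other coordinate gives no
   entropy. *)
rewrite (bigD1 x) //= big1 ?addr0 => [|y yx]; last first.
  rewrite expect_cond_Ent //; last exact: agree_off_equiv.
  apply/eqP; rewrite subr_eq0; apply/eqP; rewrite loge_eq_op //.
  apply: eq_bigr => s _; congr (_ * ln _).
  have E := @agree_off_equiv X S y.
  apply: (mulIf (lt0r_neq0 (mass_gt0 E lam0 (lam_gt0 s)))).
  rewrite cexp_mass // mass_mulr; first by rewrite mulrC.
    exact: E.
  move=> t u /forallP/(_ x); rewrite eq_sym yx /= => /eqP tu.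
  by rewrite /f tu.
have le : expect lam (cond_Ent (agree_off x) lam f) <= Ent lam f.
  rewrite expect_cond_Ent ?Ent_loge //; last exact: agree_off_equiv.
  rewrite lerD2l lerN2; apply: loge_mono => //; exact: agree_off_equiv.
have ge : 0 <= expect lam (cond_Ent (agree_off x) lam f).
  rewrite expect_cond_Ent //; last exact: agree_off_equiv.
  rewrite subr_ge0; apply: loge_mono => //; first exact: agree_off_equiv.
  by move=> s t /eqP ->; apply: equivalence_refl; apply: agree_off_equiv.
have Ent0 : 0 < Ent lam f.
  (* For values 0 and 1 the term [f ln f] vanishes; the entropy is [- p ln p], with [p] the mean,
     strictly between 0 and 1 because both [i] and [j] have positive weight. *)
  rewrite /Ent {1}/expect big1 => [|s _]; last first.
    by rewrite /f; case: eqP => _; rewrite ?ln1 ?mul0r ?mulr0.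
  have p0 : 0 < expect lam f.
    rewrite /expect (bigD1 [ffun=> i]) //= /f ffunE eqxx mulr1 ltr_pwDl //.
    by apply: sumr_ge0 => s _; rewrite mulr_ge0.
  have p1 : expect lam f < 1.
    rewrite -lam1 /expect (bigD1 [ffun=> j]) //= [X in _ < X](bigD1 [ffun=> j]) //=.
    rewrite {1}/f ffunE eq_sym (negbTE ij) mulr0 ltr_leD //.
    apply: ler_sum => s _; rewrite ler_piMr // /f.
    by case: (_ == _); rewrite ?lexx ?ler01.
  by rewrite sub0r oppr_gt0 pmulr_rlt0 // ln_lt0 // p0.
move: (Ent lam f) (expect lam _) le ge Ent0 => E D DE D0 E0 ECD.
rewrite leNgt; apply/negP => C1.
have [C0|C0] := lerP C 0.
  by have := mulr_le0_ge0 C0 D0; lra.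
have := ler_wpM2l (ltW C0) DE.
have : 0 < (1 - C) * E by rewrite mulr_gt0 // subr_gt0.
lra.
Qed.

Theorem lemma18 (R : realType) :
  exists K : R, 0 < K /\
  forall (q : nat) (beta : R) (G : sgraph) (Cspin : R),
    (2 <= q)%N -> 0 < beta ->
    entropy_factorisation (potts G q beta) Cspin ->
    let nu := edwards_sokal G q beta in
    let Cjoint :=
      K * (q%:R ^+ 3 * expR (3 * beta * (max_degree G)%:R) * Cspin) in
    (forall g : joint_config G q -> R, (forall t, 0 <= g t) ->
       Ent nu g <=
         Cjoint *
         (\sum_(v : G) expect nu (cond_Ent (agree_off_vertex v) nu g) +
          \sum_(e : edge G) expect nu (cond_Ent (agree_off_edge e) nu g)))
    /\ entropy_factorisation (random_cluster G q beta) Cjoint.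
Proof.
exists 49; split; first by rewrite ltr0n.
move=> q beta G C q2 beta0 spinC nu K.
have nu0 : forall t, 0 <= nu t := nu_ge0 beta0 q2.
have nu1 : \sum_t nu t = 1 := sum_nu _ beta0 q2.
have vE v := eq_equivalence_rel (@agree_vertexE G q v) (@agree_equiv G q _ _).
have eE e := eq_equivalence_rel (@agree_edgeE G q e) (@agree_equiv G q _ _).
have offE := agree_off_equiv.
have vS g v : expect nu (cond_Ent (agree_off_vertex v) nu g) =
    loge nu eq_op g - loge nu (agree [set v] set0) g.
  by rewrite (expect_cond_Ent nu0 g (vE v)) (eq_loge _ _ (@agree_vertexE G q v)).
have eS g e : expect nu (cond_Ent (agree_off_edge e) nu g) =
    loge nu eq_op g - loge nu (agree set0 [set e]) g.
  by rewrite (expect_cond_Ent nu0 g (eE e)) (eq_loge _ _ (@agree_edgeE G q e)).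
have jointE g : Ent nu g = loge nu eq_op g - loge nu (agree setT setT) g.
  by rewrite Ent_loge // (eq_loge _ _ (@agreeT G q)).
have Lmono (U U' : {set G}) (S S' : {set edge G}) g : (forall t, 0 <= g t) -> U \subset U' -> S \subset S' ->
    loge nu (agree U' S') g <= loge nu (agree U S) g.
  move=> g0 UU SS; apply: loge_mono => //; try exact: agree_equiv.
  exact: agreeS.
have C1 (v : G) : 1 <= C.
  have ij : Ordinal (ltnW q2) != Ordinal q2 by [].
  exact: (entropy_factorisation_ge1 v ij (potts_gt0 beta) (sum_potts G beta0 q2) spinC).
have joint (g : joint_config G q -> R) : (forall t, 0 <= g t) ->
    Ent nu g <= K *
      (\sum_(v : G) expect nu (cond_Ent (agree_off_vertex v) nu g) +
       \sum_(e : edge G) expect nu (cond_Ent (agree_off_edge e) nu g)).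
  move=> g0; rewrite jointE (eq_bigr _ (fun v _ => vS g v)).
  rewrite (eq_bigr _ (fun e _ => eS g e)).
  (* Without vertices [C] has no lower bound, but there are no edges either and both sides
     vanish. *)
  case: (pickP G) => [v _|no_vertex]; last first.
    have no_edge (e : edge G) : False.
      by have [u _] := edge_ends e; have := no_vertex u.
    rewrite !big1 => [||v _]; last by have := no_vertex v.
      rewrite addr0 mulr0 loge_id.
      rewrite -[X in _ - X](@eq_loge _ _ _ (agree set0 set0)) ?subrr //.
      move=> t u; apply/agreeP/agreeP => _; split=> [v _|e _].
      - by have := no_vertex v.
      - by case: (no_edge e).
      - by have := no_vertex v.
      - by case: (no_edge e).
    by move=> e _; case: (no_edge e).
  apply: (joint_factorisation beta0 q2 (C1 v) g0).
  (* The conditional expectation of [g] given the spins, to which the spin factorisation is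
     applied. *)
  pose f s := push fst (fun t => nu t * g t) s / potts G q beta s.
  have f0 s : 0 <= f s.
    apply: divr_ge0; last exact/ltW/potts_gt0.
    apply: sumr_ge0 => t _; exact: mulr_ge0 (ler0n _ _) (mulr_ge0 (nu0 t) (g0 t)).
  have fE s : potts G q beta s * f s = push fst (fun t => nu t * g t) s.
    by rewrite mulrC divfK // gt_eqF // potts_gt0.
  have pE a := loge_push a (pottsE beta) fE.
  have p0 s : 0 <= potts G q beta s by apply/ltW/potts_gt0.
  have wE w : expect (potts G q beta)
        (cond_Ent (agree_off w) (potts G q beta) f) =
      loge nu (agree set0 setT) g - loge nu (agree [set w] setT) g.
    rewrite (expect_cond_Ent p0 f (offE _ _ w)) !pE.
    by rewrite (eq_loge _ _ (@agree_all_edgesE G q)) (eq_loge _ _ (@agree_spinE G q w)).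
  have := spinC f f0; rewrite (eq_bigr _ (fun w _ => wE w)).
  rewrite Ent_loge ?sum_potts // !pE (eq_loge _ _ (@agree_all_edgesE G q)).
  by rewrite -(eq_loge _ _ (@agreeT G q)).
split=> // f f0; pose g (t : joint_config G q) := f t.2.
have g0 t : 0 <= g t by apply: f0.
have rcE := @random_clusterE R G q beta.
have fE A : random_cluster G q beta A * f A = push snd (fun t => nu t * g t) A.
  by rewrite rcE push_mulr.
have pE a := loge_push a rcE fE.
have rc0 A : 0 <= random_cluster G q beta A.
  by rewrite rcE; apply: sumr_ge0 => t _; apply: mulr_ge0.
(* As [g] is a function of the edges, forgetting all the spins loses nothing. *)
have gE : loge nu (agree setT set0) g = loge nu eq_op g.
  rewrite -(eq_loge _ _ (@agree_all_spinsE G q)) -(pE eq_op) !loge_eq_op //.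
  under eq_bigr do rewrite rcE -mulrA.
  by rewrite sum_push_mul; apply: eq_bigr => t _; rewrite mulrA.
rewrite Ent_loge ?sum_random_cluster // !pE (eq_loge _ _ (@agree_all_spinsE G q)).
rewrite gE -(eq_loge _ _ (@agreeT G q)) -jointE.
apply: le_trans (joint g g0) _; rewrite big1 ?add0r => [|v _]; last first.
  (* Monotonicity squeezes the vertex relation between equality and forgetting all the spins, where
     L agrees by [gE]. *)
  rewrite vS; apply/eqP; rewrite subr_eq0 eq_le -{1}gE Lmono ?subsetT //=.
  by rewrite loge_id Lmono ?sub0set.
(* An edge provides a vertex, hence [1 <= C] and a nonnegative constant for the termwise
   comparison. *)
rewrite !mulr_sumr; apply: ler_sum => e _; have [u _] := edge_ends e.
have C0 := le_trans ler01 (C1 u).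
rewrite eS (expect_cond_Ent rc0 f (offE _ _ e)) !pE (eq_loge _ _ (@agree_all_spinsE G q)) gE.
rewrite (eq_loge _ _ (@agree_rcE G q e)).
apply: ler_wpM2l; first by rewrite !mulr_ge0 ?exprn_ge0 ?expR_ge0.
(* Fixing the spins as well refines the relation, which raises L and lowers the edge term. *)
by rewrite lerD2l lerN2 Lmono ?sub0set.
Qed.
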